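(* Let $n > 3$ be an integer. Then stit logic does not have the Restricted $n$-Craig Interpolation Property $(RCIP)_n$; that is, there exist a set of propositional variables $V$ and formulas $A, B \in \mathcal{L}^{\{1,\ldots,n\}}_V$ with $\vdash A \to B$ and $Ag(A) \cap Ag(B) = \emptyset$ such that there is no $C \in \mathcal{L}^{Ag(A)\cup Ag(B)}_{|A|\cap|B|}$ with both $\vdash A \to C$ and $\vdash C \to B$.
   Context: For a finite set $Ag$ of agent indices and a set $V$ of propositional variables, $\mathcal{L}^{Ag}_V$ is the set of stit formulas given by $A ::= p \mid A \to A \mid \bot \mid \Box A \mid [j]A$ with $p \in V$, $j \in Ag$ (other Boolean connectives defined as usual; $\Diamond A := \neg\Box\neg A$). $\vdash A$ means that $A$ is derivable in the axiom system $\mathbb{S}$ whose axioms are: all classical propositional tautologies; the S5 axioms for $\Box$ and for each $[j]$; $\Box A \to [j]A$ for each $j$; and $(\Diamond[j_1]A_1 \wedge\dots\wedge \Diamond[j_k]A_k) \to \Diamond([j_1]A_1\wedge\dots\wedge[j_k]A_k)$ for pairwise distinct $j_1,\dots,j_k$; and whose rules are modus ponens and necessitation for $\Box$. (This system is sound and strongly complete for the standard branching-time stit semantics with Chellas stit operators.) For a formula $A$, $|A|$ is the set of propositional variables occurring in $A$ and $Ag(A)$ the set of agent indices occurring in $A$. *)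

(* Defs.v *)
From mathcomp Require Import all_boot.

Set Implicit Arguments.
Unset Strict Implicit.
Unset Printing Implicit Defensive.

Inductive formula (Ag : finType) (V : Type) : Type :=
| Var of V
| Imp of formula Ag V & formula Ag V
| Bot
| Box of formula Ag V
| Stit of Ag & formula Ag V.

Arguments Var {Ag V} p.
Arguments Imp {Ag V} A B.
Arguments Bot {Ag V}.
Arguments Box {Ag V} A.
Arguments Stit {Ag V} j A.

Section Stit.
Context {Ag : finType} {V : Type}.
Implicit Types A B : formula Ag V.

Definition Neg A : formula Ag V := Imp A Bot.
Definition Top : formula Ag V := Neg Bot.
Definition And A B : formula Ag V := Neg (Imp A (Neg B)).
Definition Dia A : formula Ag V := Neg (Box (Neg A)).
Definition DStit (j : Ag) A : formula Ag V := Neg (Stit j (Neg A)).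

Definition Conj (s : seq (formula Ag V)) : formula Ag V := foldr And Top s.

(* |A| *)
Fixpoint vars A (p : V) : Prop :=
  match A with
  | Var q => q = p
  | Imp B C => vars B p \/ vars C p
  | Bot => False
  | Box B => vars B p
  | Stit _ B => vars B p
  end.

(* Ag(A) *)
Fixpoint agents A : {set Ag} :=
  match A with
  | Var _ => set0
  | Imp B C => agents B :|: agents C
  | Bot => set0
  | Box B => agents B
  | Stit j B => j |: agents B
  end.

(* Membership in the sublanguage with agents in J and variables in P. *)
Fixpoint in_lang (J : {set Ag}) (P : V -> Prop) A : Prop :=
  match A with
  | Var p => P p
  | Imp B C => in_lang J P B /\ in_lang J P C
  | Bot => True
  | Box B => in_lang J P B
  | Stit j B => j \in J /\ in_lang J P B
  end.

(* Variables and modal formulas are the atoms of the propositional skeleton, so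
   [tautology] covers exactly the substitution instances of tautologies. *)
Fixpoint peval (v : formula Ag V -> bool) A : bool :=
  match A with
  | Imp B C => peval v B ==> peval v C
  | Bot => false
  | _ => v A
  end.

Definition tautology A : Prop := forall v, peval v A.

Inductive derivable : formula Ag V -> Prop :=
| ax_taut A : tautology A -> derivable A
| ax_boxK A B :
    derivable (Imp (Box (Imp A B)) (Imp (Box A) (Box B)))
| ax_boxT A : derivable (Imp (Box A) A)
| ax_box4 A : derivable (Imp (Box A) (Box (Box A)))
| ax_box5 A : derivable (Imp (Dia A) (Box (Dia A)))
| ax_stitK j A B :
    derivable (Imp (Stit j (Imp A B)) (Imp (Stit j A) (Stit j B)))
| ax_stitT j A : derivable (Imp (Stit j A) A)
| ax_stit4 j A : derivable (Imp (Stit j A) (Stit j (Stit j A)))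
| ax_stit5 j A : derivable (Imp (DStit j A) (Stit j (DStit j A)))
| ax_box_stit j A : derivable (Imp (Box A) (Stit j A))
(* Independence of agents: s lists the pairs (j_i, A_i).  The instance s = [::]
   is Top -> Dia Top, which the other axioms already derive. *)
| ax_indep (s : seq (Ag * formula Ag V)) : uniq (map fst s) ->
    derivable (Imp (Conj [seq Dia (Stit x.1 x.2) | x <- s])
                   (Dia (Conj [seq Stit x.1 x.2 | x <- s])))
| mp A B : derivable A -> derivable (Imp A B) -> derivable B
| nec A : derivable A -> derivable (Box A).

End Stit.

(* Main.v *)
Require Import Defs.
From mathcomp Require Import all_boot.

(** [A] says, with private witnesses p0 and p1, that the agents 0 and 1 can
    jointly force r; the negation of [B] says, with private witnesses p2 and p3,
    that the agents 2 and 3 can jointly force the negation of r.  Independence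
    of agents makes these incompatible, whence A -> B.  An interpolant would be
    a formula in r alone.  But if every choice cell of every single agent
    contains both an r-world and a non-r-world, then worlds agreeing on r are
    bisimilar, within a model and across models.  Two agents each picking a bit,
    with r the equality (resp. inequality) of the bits, give such models
    satisfying [A] and refuting [B]. *)

Set Implicit Arguments.
Unset Strict Implicit.
Unset Printing Implicit Defensive.

Section Semantics.
Variables (Ag : finType) (V : Type) (W : finType) (T : eqType).
Variables (ch : Ag -> W -> T) (val : V -> W -> bool).

(* A model is a single moment: [W] is its set of histories, two of which are in
   the same choice cell of [j] iff [ch j] takes the same value on them. *)
Fixpoint sat (A : formula Ag V) (w : W) : bool :=
  match A with
  | Var p => val p w
  | Imp B C => sat B w ==> sat C w
  | Bot => false
  | Box B => [forall u, sat B u]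
  | Stit j B => [forall u, (ch j u == ch j w) ==> sat B u]
  end.

(** A choice cell is given by a representative [f j]: cells picked one for each agent always share a
    history. *)
Definition independent : Prop :=
  forall f : Ag -> W, exists w, forall j, ch j w = ch j (f j).

Lemma sat_peval A w : sat A w = peval (fun B => sat B w) A.
Proof. by elim: A => //= B -> C ->. Qed.

Lemma sat_Imp A B w : sat (Imp A B) w = (sat A w ==> sat B w).
Proof. by []. Qed.

Lemma sat_Neg A w : sat (Neg A) w = ~~ sat A w.
Proof. exact: implybF. Qed.

Lemma sat_Box A w : sat (Box A) w = [forall u, sat A u].
Proof. by []. Qed.

Lemma sat_Stit j A w :
  sat (Stit j A) w = [forall u, (ch j u == ch j w) ==> sat A u].
Proof. by []. Qed.

Lemma sat_And A B w : sat (And A B) w = sat A w && sat B w.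
Proof. by rewrite /=; case: (sat A w); case: (sat B w). Qed.

Lemma sat_Dia A w : sat (Dia A) w = [exists u, sat A u].
Proof.
rewrite /= implybF negb_forall.
by apply: eq_existsb => u; rewrite implybF negbK.
Qed.

Lemma sat_DStit j A w :
  sat (DStit j A) w = [exists u, (ch j u == ch j w) && sat A u].
Proof.
rewrite /= implybF negb_forall.
by apply: eq_existsb => u; case: (_ == _); case: (sat A u).
Qed.

Lemma sat_Conj s w : sat (Conj s) w = all (fun A => sat A w) s.
Proof. by elim: s => // A s IH; rewrite [Conj _]/= sat_And IH. Qed.

Lemma sat_Stit_cell j A u w :
  ch j u = ch j w -> sat (Stit j A) u = sat (Stit j A) w.
Proof. by move=> /= ->. Qed.

(** Choose for each agent in [s] a history where its [Stit] formula holds. Independence gives a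
    history in all these cells, and the truth of a [Stit] formula is constant on a cell. *)
Lemma sat_indep (s : seq (Ag * formula Ag V)) w :
  independent -> uniq (map fst s) ->
  all (fun x => sat (Dia (Stit x.1 x.2)) w) s ->
  exists u, all (fun x => sat (Stit x.1 x.2) u) s.
Proof.
move=> indep us ss.
suff [f fP] : exists f : Ag -> W, all (fun x => sat (Stit x.1 x.2) (f x.1)) s.
  have [u uP] := indep f; exists u; apply: sub_all fP => x.
  by rewrite (sat_Stit_cell _ (uP x.1)).
elim: s us ss => [|[j A] s IH]; first by exists (fun=> w).
case/andP=> js us /andP[]; rewrite sat_Dia => /existsP[u uP] /(IH us)[f fP].
(* Since [j] does not recur in [s], redefining [f] at [j] preserves the other witnesses. *)
exists (fun i => if i == j then u else f i).
apply/andP; split; first by rewrite /= eqxx.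
elim: s js fP {IH us} => //= -[i B] s IH /=.
rewrite inE negb_or eq_sym => /andP[/negPf-> js] /andP[-> fP] /=.
exact: IH.
Qed.

Lemma soundness A : independent -> derivable A -> forall w, sat A w.
Proof.
move=> indep; elim=> {A}.
- by move=> A tA w; rewrite sat_peval.
- move=> A B w /=; apply/implyP=> /forallP AB; apply/implyP=> /forallP hA.
  by apply/forallP=> u; have /implyP := AB u; apply.
- by move=> A w /=; apply/implyP=> /forallP.
- by move=> A w /=; apply/implyP=> hA; apply/forallP.
- move=> A w; rewrite sat_Imp sat_Box sat_Dia; apply/implyP=> hA.
  by apply/forallP => u; rewrite sat_Dia.
- move=> j A B w /=; apply/implyP=> /forallP AB; apply/implyP=> /forallP hA.
  apply/forallP=> u; apply/implyP=> e.
  by have /implyP/(_ e)/implyP := AB u; apply; have /implyP := hA u; apply.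
- by move=> j A w /=; apply/implyP=> /forallP/(_ w); rewrite eqxx.
- move=> j A w; rewrite sat_Imp [X in _ ==> X]sat_Stit; apply/implyP=> hA.
  apply/forallP=> u; apply/implyP=> /eqP e.
  by rewrite (sat_Stit_cell _ e).
- move=> j A w; rewrite sat_Imp [X in _ ==> X]sat_Stit; apply/implyP=> hA.
  apply/forallP=> u; apply/implyP=> /eqP e.
  by move: hA; rewrite !sat_DStit e.
- move=> j A w /=; apply/implyP=> /forallP hA.
  by apply/forallP=> u; rewrite hA implybT.
- move=> s us w; rewrite sat_Imp sat_Conj all_map; apply/implyP=> hs.
  have [u uP] := sat_indep indep us hs.
  by rewrite sat_Dia; apply/existsP; exists u; rewrite sat_Conj all_map.
- by move=> A B _ hA _ hAB w; have /implyP := hAB w; apply.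
- by move=> A _ hA w /=; apply/forallP.
Qed.

End Semantics.

Section Bisimulation.
Variables (Ag : finType) (V : Type) (r : V).
Variables (W1 W2 : finType) (T1 T2 : eqType).
Variables (ch1 : Ag -> W1 -> T1) (val1 : V -> W1 -> bool).
Variables (ch2 : Ag -> W2 -> T2) (val2 : V -> W2 -> bool).

(** The first conjunct matches the moves of [Box], the second those of [Stit]. *)
Definition unforced (W : finType) (T : eqType)
    (ch : Ag -> W -> T) (val : V -> W -> bool) : Prop :=
  forall w b, (exists u, val r u = b) /\
    forall j, exists u, ch j u = ch j w /\ val r u = b.

(** Agreement on [r] is a bisimulation: a history of either model is matched by one of the other
    with the same [r], which can be found inside the current cell of any agent. *)
Lemma unforced_sat (J : {set Ag}) (P : V -> Prop) (C : formula Ag V) :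
  unforced ch1 val1 -> unforced ch2 val2 ->
  (forall p, P p -> p = r) -> in_lang J P C ->
  forall w1 w2, val1 r w1 = val2 r w2 ->
    sat ch1 val1 C w1 = sat ch2 val2 C w2.
Proof.
move=> free1 free2 Pr; elim: C => [p|B IHB C IHC||B IHB|j B IHB] //=.
- by move/Pr=> ->.
- by case=> /IHB{}IHB /IHC{}IHC w1 w2 e; rewrite (IHB _ _ e) (IHC _ _ e).
- move=> /IHB{}IHB w1 w2 _; apply/forallP/forallP=> hB u.
    have [[u' e] _] := free1 w1 (val2 r u).
    by rewrite -(IHB u').
  have [[u' e] _] := free2 w2 (val1 r u).
  by rewrite (IHB u u').
- case=> _ /IHB{}IHB w1 w2 _; apply/forallP/forallP=> hB u; apply/implyP=> _.
    have [_ /(_ j)[u' [c e]]] := free1 w1 (val2 r u).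
    by rewrite -(IHB u') //; have := hB u'; rewrite c eqxx.
  have [_ /(_ j)[u' [c e]]] := free2 w2 (val1 r u).
  by rewrite (IHB u u') //; have := hB u'; rewrite c eqxx.
Qed.

End Bisimulation.

Section TwoPlayers.
Variables (Ag : finType) (i j : Ag).

(** Agents other than [i] and [j] have a single cell. *)
Definition bit_choice (k : Ag) (w : bool * bool) : bool :=
  if k == i then w.1 else if k == j then w.2 else true.

Lemma bit_choice_independent : independent bit_choice.
Proof.
move=> f; exists ((f i).1, (f j).2) => k; rewrite /bit_choice.
by case: (k =P i) => [->//|_]; case: (k =P j) => [->|].
Qed.

(** An agent fixes at most one bit, and flipping the other one changes [r]. *)
Lemma bit_choice_unforced (V : Type) (r : V) (val : V -> bool * bool -> bool)
    (c : bool) :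
  (forall w, val r w = c (+) (w.1 (+) w.2)) -> unforced r bit_choice val.
Proof.
move=> valr [x y] b; split.
  by exists (c (+) b, false); rewrite valr; case: c {valr}; case: b.
move=> k; rewrite /bit_choice; case: (k =P i) => _.
  by exists (x, c (+) b (+) x); rewrite valr; case: c {valr}; case: b; case: x.
exists (c (+) b (+) y, y); rewrite valr; split=> //.
by case: c {valr}; case: b; case: y.
Qed.

End TwoPlayers.

Section CanForce.
Variables (Ag : finType) (V : Type).
Implicit Types (p q : V) (A B C : formula Ag V).

Definition can_force (i j : Ag) p q A : formula Ag V :=
  And (And (Dia (Stit i (Var p))) (Dia (Stit j (Var q))))
      (Box (Imp (Var p) (Imp (Var q) A))).

Lemma derivable_box2 A B C :
  derivable (Imp A (Imp B C)) -> derivable (Imp (Box A) (Imp (Box B) (Box C))).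
Proof.
move=> /nec/mp/(_ (ax_boxK _ _)) h.
apply: mp (ax_boxK B C) (mp h (ax_taut _)) => v /=.
by do ![case: (v _) => //=].
Qed.

(** Independence of the four distinct agents yields a history where [p], [q], [s] and [t] all hold;
    the boxed implications then give both [A] and its negation there. *)
Lemma can_force_incompatible (i j k l : Ag) (p q s t : V) A :
  uniq [:: i; j; k; l] ->
  derivable (Imp (can_force i j p q A) (Neg (can_force k l s t (Neg A)))).
Proof.
move=> us.
pose X := [:: (i, Var p : formula Ag V); (j, Var q); (k, Var s); (l, Var t)].
have indep := @ax_indep Ag V X us.
have clash : derivable (Imp (Imp (Var p) (Imp (Var q) A))
    (Imp (Imp (Var s) (Imp (Var t) (Neg A)))
         (Neg (Conj [seq Stit x.1 x.2 | x <- X])))).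
  apply: mp (ax_stitT i (Var p)) (mp (ax_stitT j (Var q))
    (mp (ax_stitT k (Var s)) (mp (ax_stitT l (Var t)) (ax_taut _)))) => u /=.
  by case: (peval u A); do ![case: (u _) => //=].
apply: mp (derivable_box2 clash) (mp indep (ax_taut _)) => u /=.
by do ![case: (u _) => //=].
Qed.

(** [(true, true)] is the only history where [p] and [q] both hold. *)
Lemma sat_can_force (i j : Ag) p q A (val : V -> bool * bool -> bool) w :
  i != j ->
  (forall u, val p u = u.1) -> (forall u, val q u = u.2) ->
  sat (bit_choice i j) val A (true, true) ->
  sat (bit_choice i j) val (can_force i j p q A) w.
Proof.
move=> ij vp vq hA; rewrite !sat_And !sat_Dia; apply/andP; split.
  apply/andP; split; apply/existsP; exists (true, true);
    apply/forallP=> u; apply/implyP; rewrite /bit_choice !eqxx /=.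
    by rewrite vp => /eqP.
  by rewrite [j == i]eq_sym (negPf ij) vq => /eqP.
by apply/forallP=> -[x y] /=; rewrite vp vq; case: x; case: y.
Qed.

End CanForce.

Theorem theorem2 (n : nat) (hn : 3 < n) :
  exists (V : Type) (A B : formula 'I_n V),
    [/\ derivable (Imp A B),
        agents A :&: agents B = set0
      & ~ exists C : formula 'I_n V,
          [/\ in_lang (agents A :|: agents B) (fun p => vars A p /\ vars B p) C,
              derivable (Imp A C)
            & derivable (Imp C B)]].
Proof.
pose a k (hk : k < 4) : 'I_n := Ordinal (leq_trans hk hn).
pose i := @a 0 isT; pose j := @a 1 isT; pose k := @a 2 isT; pose l := @a 3 isT.
pose A : formula 'I_n nat := can_force i j 0 1 (Var 4).
pose B : formula 'I_n nat := Neg (can_force k l 2 3 (Neg (Var 4))).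
exists nat, A, B; split.
- exact: can_force_incompatible.
- apply/setP=> x; rewrite /= !inE -!val_eqE /=.
  by case: (val x) => [|[|[|[|m]]]].
case=> C [langC AC CB].
(* Variables 0 and 1 are the witnesses in [A], 2 and 3 those in [B], and 4 is the shared [r]:
   equality of the bits if [c] is true, inequality if it is false. *)
pose val c (p : nat) (w : bool * bool) : bool :=
  match p with
  | 0 | 2 => w.1
  | 1 | 3 => w.2
  | _ => c (+) (w.1 (+) w.2)
  end.
have Ctrue : sat (bit_choice i j) (val true) C (true, true).
  have := soundness (val true) (bit_choice_independent i j) AC (true, true).
  by rewrite sat_Imp => /implyP; apply; apply: sat_can_force.
(* Here [r] is true under inequality, as it is at [(true, true)] under equality, so [C] passes from
   one model to the other. *)
have Btrue : sat (bit_choice k l) (val false) B (true, false).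
  have := soundness (val false) (bit_choice_independent k l) CB (true, false).
  rewrite sat_Imp => /implyP; apply.
  rewrite -(unforced_sat _ _ _ langC (w1 := (true, true)) (r := 4)
    (ch1 := bit_choice i j) (val1 := val true)) //.
  + exact: bit_choice_unforced.
  + exact: bit_choice_unforced.
  + by move=> p []; rewrite /=; intuition; subst.
(* Under inequality [r] fails at [(true, true)], so [k] and [l] can force its negation. *)
move: Btrue; rewrite sat_Neg => /negP; apply.
exact: sat_can_force.
Qed.
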